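(* If $p^m>d_\Phi+d_M$, then the analytic vector bundle $\mathcal L\to\mathfrak D^{(m),o}_{\mathrm{KZ}}$ is of rank $g$; that is, $\dim_{\mathbb Q_p^{(m)}}\mathcal L_a=g$ for every $a\in\mathfrak D^{(m),o}_{\mathrm{KZ}}$.
   Context: Let $p>q$ be prime numbers, $p$ odd, and let $e$ be the order of $p$ modulo $q$ (the least positive integer with $p^e\equiv1\pmod q$). Let $g$ be a positive integer and $n=gq+1$. Assume $p^e>n$ and $p\ge n+q-2$. Let $t$ be one variable and $z=(z_1,\dots,z_n)$. For $s\ge1$ put $\Phi_s(t,z)=\big((t-z_1)\cdots(t-z_n)\big)^{(p^{es}-1)/q}$. Let $A(\Phi_s(t,z))$ be the $g\times g$ matrix whose $(u,v)$ entry, $u,v=1,\dots,g$, is the coefficient of $t^{p^{es}v-u}$ in $\Phi_s(t,z)$; its entries are in $\mathbb Z[z]$. Let $I_s(z)$ be the $n\times g$ matrix whose entry in row $i$ and column $\ell$ is the coefficient of $t^{\ell p^{es}-1}$ in $\Phi_s(t,z)/(t-z_i)$. The numbers are $d_\Phi=\frac{p^e-1}{q}\cdot\frac{qg^2+2g-qg}{2}$, the degree of the homogeneous polynomial $\det A(\Phi_1(t,z))$, and $d_M=\frac{p^e-1}{q}\cdot\frac{qg^2+2g-qg}{2}-\frac{g(g+1)}{2}$, the degree of the $g\times g$ minor of $I_1(z)$ in the rows with indices $q(g-\ell)+1$, $\ell=1,\dots,g$. Let $m$ be a positive integer, $\mathbb Q_p^{(m)}$ the unramified extension of $\mathbb Q_p$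 of degree $m$, $\mathbb Z_p^{(m)}$ its ring of integers, and $|\cdot|_p$ the extension of the $p$-adic norm. Put $\mathfrak D^{(m)}_{\mathrm{KZ}}=\{a\in(\mathbb Z_p^{(m)})^n : |\det A(\Phi_1(t,a))|_p=1\}$ and $\mathfrak D^{(m),o}_{\mathrm{KZ}}=\{a=(a_1,\dots,a_n)\in\mathfrak D^{(m)}_{\mathrm{KZ}} : a_i\ne a_j \text{ for all } i\neq j\}$. A function on such a domain is analytic if it is given by convergent power series on the unit polydiscs $\{|z_j-\tilde u_j|_p<1\}$ of $\mathfrak D^{(m)}_{\mathrm{KZ}}$. The $n\times g$ matrices $I_s(z)\,A(\Phi_s(t,z))^{-1}$ have entries that are rational functions regular on $\mathfrak D^{(m)}_{\mathrm{KZ}}$, and they converge uniformly there as $s\to\infty$ to an analytic $n\times g$ matrix denoted $\mathcal I(z)$. Let $W=\{(I_1,\dots,I_n)\in(\mathbb Q_p^{(m)})^n : I_1+\dots+I_n=0\}$ (column vectors). For $a\in\mathfrak D^{(m)}_{\mathrm{KZ}}$ let $\mathcal L_a\subset W$ be the $\mathbb Q_p^{(m)}$-subspace spanned by the columns of $\mathcal I(a)$, and $\mathcal L=\bigcup_a\mathcal L_a$. *)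

(* Defs.v *)
From HB Require Import structures.
From mathcomp Require Import all_boot all_order all_algebra all_field.
From mathcomp Require Import boolp classical_sets reals.

Set Implicit Arguments.
Unset Strict Implicit.
Unset Printing Implicit Defensive.

Import Order.TTheory GRing.Theory Num.Theory.
Local Open Scope ring_scope.
Local Open Scope classical_set_scope.

Definition is_order_mod (p q e : nat) : Prop :=
  [/\ (0 < e)%N, (p ^ e = 1 %[mod q])%N
    & forall k : nat, (0 < k)%N -> (p ^ k = 1 %[mod q])%N -> (e <= k)%N].

Record nonarch_absval (R : realType) (F : fieldType) (abs : F -> R) : Prop := {
  absval_ge0 : forall x, 0 <= abs x;
  absval_eq0 : forall x, abs x = 0 <-> x = 0;
  absvalM : forall x y, abs (x * y) = abs x * abs y;
  absval_ultra : forall x y, abs (x + y) <= Num.max (abs x) (abs y)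
}.

Definition padic_norm (R : realType) (p : nat) (x : rat) : R :=
  if x == 0 then 0
  else p%:R ^+ logn p `|denq x|%N / p%:R ^+ logn p `|numq x|%N.

Definition cauchy_for (R : realType) (F : fieldType) (abs : F -> R)
    (u : nat -> F) : Prop :=
  forall eps : R, 0 < eps -> exists N : nat, forall i j : nat,
    (N <= i)%N -> (N <= j)%N -> abs (u i - u j) < eps.

Definition converges_to (R : realType) (F : fieldType) (abs : F -> R)
    (u : nat -> F) (l : F) : Prop :=
  forall eps : R, 0 < eps -> exists N : nat, forall i : nat,
    (N <= i)%N -> abs (u i - l) < eps.

(* [Qp] with [abs] is the completion of the rationals for the p-adic norm;
   this determines the pair up to a unique isometric isomorphism. *)
Record is_Qp (R : realType) (p : nat) (Qp : fieldType) (abs : Qp -> R) : Prop := {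
  Qp_absval : nonarch_absval abs;
  Qp_norm : forall x : rat, abs (ratr x) = padic_norm R p x;
  Qp_dense : forall (x : Qp) (eps : R), 0 < eps ->
    exists y : rat, abs (x - ratr y) < eps;
  Qp_complete : forall u : nat -> Qp, cauchy_for abs u ->
    exists l : Qp, converges_to abs u l
}.

(* Unramified means that the ramification index, i.e. the index of the value
   group of [Qp] in that of [K], is 1. Separability of the residue field
   extension is automatic, the residue field of Q_p being finite. *)
Record is_unramified_ext (R : realType) (Qp : fieldType) (abs : Qp -> R)
    (m : nat) (K : fieldExtType Qp) (norm : K -> R) : Prop := {
  unram_absval : nonarch_absval norm;
  unram_extends : forall x : Qp, norm (x%:A) = abs x;
  unram_degree : \dim {:K} = m;
  unram_value_group : forall x : K, x != 0 -> exists y : Qp, norm x = abs y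
}.

(* The polynomials and matrices below are defined over an arbitrary domain,
   so that [z] may be the tuple of variables of Z[z_1, ..., z_n] as well as a
   point with coordinates in a field. Rows and columns are numbered from 0,
   hence the successors in the exponents. *)
Definition Phi (R : idomainType) (p q e s n : nat) (z : 'I_n -> R) : {poly R} :=
  (\prod_(i < n) ('X - (z i)%:P)) ^+ ((p ^ (e * s) - 1) %/ q)%N.

Definition Amx (R : idomainType) (p q e s g n : nat) (z : 'I_n -> R) : 'M[R]_g :=
  \matrix_(u < g, v < g) (Phi p q e s z)`_(p ^ (e * s) * v.+1 - u.+1)%N.

Definition Imx (R : idomainType) (p q e s g n : nat) (z : 'I_n -> R) :
    'M[R]_(n, g) :=
  \matrix_(i < n, l < g)
    (Phi p q e s z %/ ('X - (z i)%:P))`_(l.+1 * p ^ (e * s) - 1)%N.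

Definition d_Phi (p q e g : nat) : nat :=
  ((p ^ e - 1) %/ q * ((q * g ^ 2 + 2 * g - q * g) %/ 2))%N.

(* The subtraction never truncates for g, q > 0 and p ^ e > q. *)
Definition d_M (p q e g : nat) : nat :=
  ((p ^ e - 1) %/ q * ((q * g ^ 2 + 2 * g - q * g) %/ 2) - g * (g + 1) %/ 2)%N.

Definition D_KZ (R : realType) (K : fieldType) (norm : K -> R)
    (p q e g n : nat) : set ('I_n -> K) :=
  [set a | (forall i, norm (a i) <= 1) /\ norm (\det (Amx p q e 1 g a)) = 1].

Definition D_KZo (R : realType) (K : fieldType) (norm : K -> R)
    (p q e g n : nat) : set ('I_n -> K) :=
  [set a | D_KZ norm p q e g a /\ forall i j, i != j -> a i != a j].

Definition uniform_limit_on (R : realType) (K : fieldType) (norm : K -> R)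
    (n g : nat) (D : set ('I_n -> K))
    (f : nat -> ('I_n -> K) -> 'M[K]_(n, g)) (J : ('I_n -> K) -> 'M[K]_(n, g)) :
    Prop :=
  forall eps : R, 0 < eps -> exists N : nat, forall s : nat, (N <= s)%N ->
    forall a, D a -> forall i l, norm (f s a i l - J a i l) < eps.

(* The uniform limit is unique on [D_KZ]; off [D_KZ] the value is arbitrary. *)
Definition calI (R : realType) (K : fieldType) (norm : K -> R)
    (p q e g n : nat) : ('I_n -> K) -> 'M[K]_(n, g) :=
  xget (fun _ => 0)
    [set J | uniform_limit_on norm (@D_KZ R K norm p q e g n)
               (fun s a => Imx p q e s g a *m invmx (Amx p q e s g a)) J].

(* The columns of [calI a] have coordinate sum 0, so this span lies in the
   hyperplane W of vectors with that property. *)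
Definition calL (R : realType) (K : fieldType) (norm : K -> R)
    (p q e g n : nat) (a : 'I_n -> K) : {vspace 'cV[K]_n} :=
  <<[seq col l (calI norm p q e g a) | l <- enum 'I_g]>>%VS.

(* Main.v *)
(* Write P = (t - a_1)...(t - a_n), x = p^e and N_s = (x^s - 1)/q, so that
   Phi_s = P^N_s, and let rho = |p| < 1.

   Convergence: telescoping f(t)^(x^s) = f1(t^x)^(x^(s-1)) mod p^s writes
   P^N_(s+1) as a sum of products P^N_i T_i(t^(x^i)), i <= s, with T_i divisible
   by p^(s-i). Comparing coefficients, I_(s+1) and A_(s+1) are, modulo p^s,
   combinations of the p^(s-i) I_i B_i and of the p^(s-i) A_i B_i with the same
   matrices B_i. Hence J_s = I_s A_s^-1 satisfies J_(s+1) = J_s mod p^s on the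
   domain where |det A_1| = 1.

   Rank: let c be a relation between the columns of the limit at a point a with
   distinct coordinates, and y = A_s^-1 c. Consider the functional
     lambda(f) = sum_l y_l [t^(l x^s - 1)] (P^(N_s - 1) f).
   Then lambda(P/(t - a_i)) = (J_s c)_i tends to 0, and the P/(t - a_i) span the
   polynomials of degree < n. Moreover lambda is divisible by p^(es) on those f
   for which P^(N_s - 1) f is the derivative of P^N_s t^k, and for k = 1, ..., g
   such an f has degree n + k - 1 and leading coefficient N_s n + k, a unit since
   q (N_s n + k) = - (q (g - k) + 1) mod p. So lambda is small on all polynomials
   of degree < n + g, in particular on P t^(u-1), where its value is c_u; as s is
   arbitrary, c = 0. *)

Require Import Defs.
From HB Require Import structures.
From mathcomp Require Import all_boot all_order all_algebra all_field.
From mathcomp Require Import boolp classical_sets reals.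
From mathcomp Require Import perm zify ring.

Set Implicit Arguments.
Unset Strict Implicit.
Unset Printing Implicit Defensive.

Import Order.TTheory GRing.Theory Num.Theory.
Local Open Scope ring_scope.

(** * Nonarchimedean absolute values and Gauss norms *)

Section NonarchimedeanAbsval.
Variables (R : realType) (F : fieldType) (norm : F -> R).
Hypothesis normP : nonarch_absval norm.

Lemma nabs0 : norm 0 = 0. Proof. exact/(absval_eq0 normP). Qed.

Lemma nabs_gt0 x : x != 0 -> 0 < norm x.
Proof.
move=> x0; rewrite lt_neqAle (absval_ge0 normP) andbT eq_sym.
by apply: contra_neq x0 => /(absval_eq0 normP).
Qed.

Lemma nabs1 : norm 1 = 1.
Proof.
have n0 : norm 1 != 0 by rewrite gt_eqF // nabs_gt0 ?oner_eq0.
by apply: (mulfI n0); rewrite -(absvalM normP) !mulr1.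
Qed.

Lemma nabsN x : norm (- x) = norm x.
Proof.
have : norm (-1) ^+ 2 = 1 by rewrite expr2 -(absvalM normP) mulrNN mulr1 nabs1.
move=> /eqP; rewrite sqrp_eq1 ?(absval_ge0 normP) // => /eqP n1.
by rewrite -mulN1r (absvalM normP) n1 mul1r.
Qed.

Lemma nabsX x k : norm (x ^+ k) = norm x ^+ k.
Proof.
by elim: k => [|k IH]; rewrite ?expr0 ?nabs1 // !exprS (absvalM normP) IH.
Qed.

Lemma nabsV x : norm x^-1 = (norm x)^-1.
Proof.
have [->|x0] := eqVneq x 0; first by rewrite invr0 nabs0 invr0.
have nx0 : norm x != 0 by rewrite gt_eqF // nabs_gt0.
by apply: (mulfI nx0); rewrite -(absvalM normP) divff // divff // nabs1.
Qed.

Lemma nabsD_le r x y : norm x <= r -> norm y <= r -> norm (x + y) <= r.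
Proof.
by move=> xr yr; apply: le_trans (absval_ultra normP _ _) _; rewrite ge_max xr.
Qed.

Lemma nabsB_le r x y : norm x <= r -> norm y <= r -> norm (x - y) <= r.
Proof. by move=> xr yr; apply: nabsD_le => //; rewrite nabsN. Qed.

Lemma nabs_sum_le (I : Type) (s : seq I) (P : pred I) (f : I -> F) r :
  0 <= r -> (forall i, P i -> norm (f i) <= r) ->
  norm (\sum_(i <- s | P i) f i) <= r.
Proof.
move=> r0 fr; elim/big_ind: _ => //; first by rewrite nabs0.
by move=> x y; apply: nabsD_le.
Qed.

Lemma nabsM_le r s x y : norm x <= r -> norm y <= s -> norm (x * y) <= r * s.
Proof.
by move=> xr ys; rewrite (absvalM normP) ler_pM ?(absval_ge0 normP).
Qed.

Lemma nabsM1_le r x y : norm x <= 1 -> norm y <= r -> norm (x * y) <= r.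
Proof. by move=> x1 yr; rewrite -[r]mul1r nabsM_le. Qed.

Lemma nabs_nat k : norm k%:R <= 1.
Proof.
elim: k => [|k IH]; first by rewrite nabs0.
by rewrite -natr1 nabsD_le ?nabs1.
Qed.

Lemma nabs_prod (I : Type) (s : seq I) (P : pred I) (f : I -> F) :
  norm (\prod_(i <- s | P i) f i) = \prod_(i <- s | P i) norm (f i).
Proof. by apply: (big_morph _ (absvalM normP) nabs1). Qed.

Lemma nabs_eq1 x y : norm y = 1 -> norm (x - y) < 1 -> norm x = 1.
Proof.
move=> y1 xy; apply/eqP; rewrite eq_le; apply/andP; split.
  by rewrite -[x](subrK y) nabsD_le ?y1 // ltW.
rewrite leNgt; apply/negP => x1.
have : norm y < 1.
  rewrite -[y](subKr x) (le_lt_trans (absval_ultra normP _ _)) //.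
  by rewrite gt_max x1 nabsN.
by rewrite y1 ltxx.
Qed.

Lemma nabs_det_le1 k (A : 'M[F]_k) :
  (forall i j, norm (A i j) <= 1) -> norm (\det A) <= 1.
Proof.
move=> A1; apply: nabs_sum_le => // s _; apply: nabsM1_le.
  by rewrite nabsX nabsN nabs1 expr1n.
by rewrite nabs_prod prodr_ile1 // => i _; rewrite (absval_ge0 normP) A1.
Qed.

Lemma nabs_mulmx_le k l h (A : 'M[F]_(k, l)) (B : 'M[F]_(l, h)) r s i j :
  0 <= r -> 0 <= s ->
  (forall i, norm (A j i) <= r) -> (forall i l, norm (B i l) <= s) ->
  norm ((A *m B) j i) <= r * s.
Proof.
by move=> r0 s0 Ar Bs; rewrite mxE nabs_sum_le ?mulr_ge0 // => w _; apply: nabsM_le.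
Qed.

Lemma nabs_invmx_le1 k (A : 'M[F]_k) :
  (forall i j, norm (A i j) <= 1) -> norm (\det A) = 1 ->
  forall i j, norm (invmx A i j) <= 1.
Proof.
move=> A1 detA i j; have uA : A \in unitmx.
  rewrite unitmxE unitfE; apply: contra_eq_neq detA => ->.
  by rewrite nabs0 eq_sym oner_eq0.
rewrite /invmx uA !mxE nabsM1_le ?nabsV ?detA ?invr1 //.
apply: nabsM1_le; first by rewrite nabsX nabsN nabs1 expr1n.
by apply: nabs_det_le1 => a b; rewrite !mxE.
Qed.

Definition gauss_le (r : R) (f : {poly F}) := forall i, norm f`_i <= r.

Lemma gauss_leW r s f : r <= s -> gauss_le r f -> gauss_le s f.
Proof. by move=> rs fr i; apply: le_trans (fr i) rs. Qed.

Lemma gauss_leD r f h : gauss_le r f -> gauss_le r h -> gauss_le r (f + h).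
Proof. by move=> fr hr i; rewrite coefD nabsD_le. Qed.

Lemma gauss_leN r f : gauss_le r f -> gauss_le r (- f).
Proof. by move=> fr i; rewrite coefN nabsN. Qed.

Lemma gauss_leB r f h : gauss_le r f -> gauss_le r h -> gauss_le r (f - h).
Proof. by move=> fr hr; apply/gauss_leD/gauss_leN. Qed.

Lemma gauss_le_sum r (I : Type) (s : seq I) (P : pred I) (f : I -> {poly F}) :
  0 <= r -> (forall i, P i -> gauss_le r (f i)) ->
  gauss_le r (\sum_(i <- s | P i) f i).
Proof. by move=> r0 fr j; rewrite coef_sum nabs_sum_le // => i /fr. Qed.

Lemma gauss_le_ge0 r f : gauss_le r f -> 0 <= r.
Proof. by move=> /(_ 0%N); apply: le_trans (absval_ge0 normP _). Qed.

Lemma gauss_leM r s f h :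
  gauss_le r f -> gauss_le s h -> gauss_le (r * s) (f * h).
Proof.
move=> fr hs i; have r0 := gauss_le_ge0 fr; have s0 := gauss_le_ge0 hs.
by rewrite coefM nabs_sum_le ?mulr_ge0 // => j _; apply: nabsM_le.
Qed.

Lemma gauss_leM1 r f h :
  gauss_le 1 f -> gauss_le r h -> gauss_le r (f * h).
Proof. by move=> f1 hr; rewrite -[r]mul1r; apply: gauss_leM. Qed.

Lemma gauss_leC r c : norm c <= r -> gauss_le r c%:P.
Proof.
move=> cr i; rewrite coefC; case: eqP; rewrite ?nabs0 // => _.
exact: le_trans (absval_ge0 normP _) cr.
Qed.

Lemma gauss_leXn k : gauss_le 1 'X^k.
Proof. by move=> i; rewrite coefXn nabs_nat. Qed.

Lemma gauss_le1 : gauss_le 1 1.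
Proof. by move=> i; rewrite coef1 nabs_nat. Qed.

Lemma gauss_le_exp f k : gauss_le 1 f -> gauss_le 1 (f ^+ k).
Proof.
move=> f1; elim: k => [|k IH]; first exact: gauss_le1.
by rewrite exprS; apply: gauss_leM1.
Qed.

Lemma gauss_le_prod (I : Type) (s : seq I) (P : pred I) (f : I -> {poly F}) :
  (forall i, P i -> gauss_le 1 (f i)) -> gauss_le 1 (\prod_(i <- s | P i) f i).
Proof.
move=> f1; elim/big_ind: _ => //; first exact: gauss_le1.
by move=> ? ?; apply: gauss_leM1.
Qed.

Lemma gauss_le_XsubC c : norm c <= 1 -> gauss_le 1 ('X - c%:P).
Proof.
by move=> c1; apply: gauss_leB; [apply: (@gauss_leXn 1) | apply: gauss_leC].
Qed.

Lemma gauss_le_comp_Xn r f k : gauss_le r f -> gauss_le r (f \Po 'X^k).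
Proof.
move=> fr; have r0 := gauss_le_ge0 fr.
rewrite comp_polyE; apply: gauss_le_sum => // i _.
rewrite -mul_polyC mulrC -exprM; apply: gauss_leM1 => //.
  exact: gauss_leXn.
exact: gauss_leC.
Qed.

(** * Frobenius congruences in the Gauss norm *)

Section Frobenius.
Variable p : nat.
Hypotheses (p_prime : prime p) (np_lt1 : norm p%:R < 1).
Local Notation rho := (norm p%:R).

Let rho_ge0 : 0 <= rho. Proof. exact: absval_ge0 normP _. Qed.
Let rho_le1 : rho <= 1. Proof. exact: ltW. Qed.

Lemma nabs_dvdn k : (p %| k)%N -> norm k%:R <= rho.
Proof. by case/dvdnP=> c ->; rewrite natrM nabsM1_le ?nabs_nat. Qed.

(** Bezout: if both [k] and [p] had norm below 1, so would 1. *)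
Lemma nabs_coprime k : ~~ (p %| k)%N -> norm k%:R = 1.
Proof.
rewrite -prime_coprime // => cpk; have p0 := prime_gt0 p_prime.
have [u v uv _] := egcdnP k p0; move: uv; rewrite (eqP cpk) => uv.
apply/eqP; rewrite eq_le nabs_nat /= leNgt; apply/negP => k1.
have : norm 1 < 1; last by rewrite nabs1 ltxx.
have -> : 1 = (u * p)%:R - (v * k)%:R :> F by rewrite uv natrD addrC addKr.
apply: le_lt_trans (absval_ultra normP _ _) _; rewrite nabsN gt_max !natrM.
apply/andP; split; first exact: le_lt_trans (nabsM1_le (nabs_nat u) _) np_lt1.
exact: le_lt_trans (nabsM1_le (nabs_nat v) _) k1.
Qed.

Lemma gauss_le_nat k : gauss_le (norm k%:R) k%:R.
Proof.
move=> i; rewrite -polyC_natr coefC; case: eqP => // _.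
by rewrite nabs0 (absval_ge0 normP).
Qed.

Lemma gauss_le_exprpD f h : gauss_le 1 f -> gauss_le 1 h ->
  gauss_le rho ((f + h) ^+ p - (f ^+ p + h ^+ p)).
Proof.
move=> f1 h1; have [k def_p] : exists k, p = k.+1.
  by exists p.-1; rewrite prednK ?prime_gt0.
have -> : (f + h) ^+ p - (f ^+ p + h ^+ p) =
    \sum_(i < k) f ^+ (p - i.+1) * h ^+ i.+1 *+ 'C(p, i.+1).
  rewrite def_p exprDn big_ord_recl big_ord_recr /= /bump.
  rewrite subn0 add1n subnn bin0 binn !expr0 mulr1 mul1r !mulr1n.
  by rewrite opprD addrACA subrr add0r addrK; apply: eq_bigr.
apply: gauss_le_sum => // i _; rewrite -[_ *+ 'C(_, _)]mulr_natr; apply: gauss_leM1.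
  by apply: gauss_leM1; apply: gauss_le_exp.
apply: gauss_leW (gauss_le_nat _); apply: nabs_dvdn.
by rewrite prime_dvd_bin //= def_p ltnS ltn_ord.
Qed.

Lemma gauss_le_subrX f h r k : gauss_le 1 f -> gauss_le 1 h ->
  gauss_le r (f - h) -> gauss_le r (f ^+ k - h ^+ k).
Proof.
move=> f1 h1 fh; rewrite subrXX mulrC; apply: gauss_leM1 => //.
by apply: gauss_le_sum => // i _; apply: gauss_leM1; apply: gauss_le_exp.
Qed.

(** The cofactor of [f - h] in [f ^+ p - h ^+ p] is [h ^+ p.-1 * p%:R] modulo [f - h], so its norm
    is at most [rho]: each p-th power gains one factor [rho]. *)
Lemma gauss_le_subrXp f h r : gauss_le 1 f -> gauss_le 1 h -> r <= rho ->
  gauss_le r (f - h) -> gauss_le (r * rho) (f ^+ p - h ^+ p).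
Proof.
move=> f1 h1 r_rho fh; rewrite subrXX; apply: gauss_leM => //.
have -> : \sum_(i < p) f ^+ (p.-1 - i) * h ^+ i =
  \sum_(i < p) (f ^+ (p.-1 - i) - h ^+ (p.-1 - i)) * h ^+ i + h ^+ p.-1 * p%:R.
  have -> : h ^+ p.-1 * p%:R = \sum_(i < p) h ^+ (p.-1 - i) * h ^+ i.
    rewrite (eq_bigr (fun=> h ^+ p.-1)) => [|i _].
      by rewrite sumr_const card_ord mulr_natr.
    by rewrite -exprD subnK // -ltnS prednK ?ltn_ord ?prime_gt0.
  by rewrite -big_split; apply: eq_bigr => i _ /=; rewrite -mulrDl subrK.
apply: gauss_leD; last first.
  by apply: gauss_leM1; [apply: gauss_le_exp | apply: gauss_le_nat].
apply: gauss_le_sum => // i _; rewrite mulrC; apply: gauss_leM1.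
  exact: gauss_le_exp.
by apply: gauss_leW r_rho _; apply: gauss_le_subrX.
Qed.

Lemma gauss_le_subr_exp f h k : gauss_le 1 f -> gauss_le 1 h ->
  gauss_le rho (f - h) -> gauss_le (rho ^+ k.+1) (f ^+ (p ^ k) - h ^+ (p ^ k)).
Proof.
move=> f1 h1 fh; elim: k => [|k IH]; first by rewrite expn0 !expr1.
rewrite expnSr !exprM [rho ^+ _.+2]exprSr.
apply: gauss_le_subrXp; try exact: gauss_le_exp.
  by rewrite exprS ler_piMr ?exprn_ile1.
exact: IH.
Qed.

Lemma gauss_le_exprD f h k : gauss_le 1 f -> gauss_le 1 h ->
  gauss_le rho ((f + h) ^+ (p ^ k) - (f ^+ (p ^ k) + h ^+ (p ^ k))).
Proof.
move=> f1 h1; elim: k => [|k IH].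
  by rewrite expn0 !expr1 subrr => i; rewrite coef0 nabs0.
rewrite expnSr !exprM.
have fh1 : gauss_le 1 (f ^+ (p ^ k) + h ^+ (p ^ k)).
  by apply: gauss_leD; apply: gauss_le_exp.
rewrite -(subrKA ((f ^+ (p ^ k) + h ^+ (p ^ k)) ^+ p)); apply: gauss_leD.
  by apply: gauss_le_subrX => //; apply: gauss_le_exp; apply: gauss_leD.
by apply: gauss_le_exprpD; apply: gauss_le_exp.
Qed.

Lemma gauss_le_exp_sum (I : Type) (s : seq I) (P : pred I)
    (f : I -> {poly F}) k :
  (forall i, P i -> gauss_le 1 (f i)) ->
  gauss_le rho ((\sum_(i <- s | P i) f i) ^+ (p ^ k)
                - \sum_(i <- s | P i) f i ^+ (p ^ k)).
Proof.
move=> f1; elim: s => [|i s IH].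
  rewrite !big_nil expr0n expn_eq0 eqn0Ngt prime_gt0 // subr0 => j.
  by rewrite coef0 nabs0.
rewrite !big_cons; case: ifP => // Pi.
rewrite -(subrKA (f i ^+ (p ^ k) + (\sum_(j <- s | P j) f j) ^+ (p ^ k))).
apply: gauss_leD; first by apply/gauss_le_exprD/gauss_le_sum; first exact: f1.
by rewrite opprD addrACA subrr add0r.
Qed.

(** For integral [f] this reduces modulo p to the Frobenius twist of [f]; powers of the coefficients
    stand in for a lift of Frobenius to the field. *)
Definition frob_poly k (f : {poly F}) : {poly F} :=
  \poly_(i < size f) (f`_i ^+ (p ^ k)).

Lemma coef_frob_poly k f i : (frob_poly k f)`_i = f`_i ^+ (p ^ k).
Proof.
rewrite coef_poly; case: ltnP => // /leq_sizeP -> //.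
by rewrite expr0n expn_eq0 eqn0Ngt prime_gt0.
Qed.

Lemma gauss_le_frob_poly k f : gauss_le 1 f -> gauss_le 1 (frob_poly k f).
Proof.
by move=> f1 i; rewrite coef_frob_poly nabsX exprn_ile1 ?(absval_ge0 normP).
Qed.

Lemma gauss_le_exp_frob k f : gauss_le 1 f ->
  gauss_le rho (f ^+ (p ^ k) - (frob_poly k f \Po 'X^(p ^ k))).
Proof.
move=> f1.
have -> : frob_poly k f \Po 'X^(p ^ k) =
    \sum_(i < size f) (f`_i *: 'X^i) ^+ (p ^ k).
  rewrite /frob_poly poly_def raddf_sum; apply: eq_bigr => i _ /=.
  by rewrite comp_polyZ comp_Xn_poly exprZn -!exprM mulnC.
rewrite -{1}[f]coefK poly_def; apply: gauss_le_exp_sum => i _.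
rewrite -mul_polyC; apply: gauss_leM1; last exact: gauss_leXn.
exact: gauss_leC.
Qed.

Variable e : nat.
Hypothesis e_gt0 : (0 < e)%N.
Local Notation x := (p ^ e)%N.

Lemma comp_poly_XnM (f : {poly F}) j k :
  (f \Po 'X^j) \Po 'X^k = f \Po 'X^(k * j).
Proof. by rewrite -comp_polyA comp_Xn_poly exprM. Qed.

(** Induction on [s]: [f ^+ x] agrees modulo p with a polynomial [f'] in ['X^x], and raising both to
    the power [x ^ s] improves the error to [rho ^+ (e * s).+1], hence to [rho ^+ s.+1]. The main
    term [f' ^+ (x ^ s)] is the [x ^ s]-th power of the twist of [f], composed with ['X^x], so the
    induction hypothesis applies to it. *)
Lemma gauss_le_exp_decomp f s : gauss_le 1 f ->
  exists2 T : nat -> {poly F}, forall k, (k <= s)%N -> gauss_le (rho ^+ (s - k)) (T k)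
    & f ^+ (x ^ s) = \sum_(k < s.+1) (T k \Po 'X^(x ^ k)).
Proof.
elim: s f => [|s IH] f f1.
  exists (fun=> f) => [k|]; first by rewrite leqn0 => /eqP ->.
  by rewrite big_ord1 /= expn0 !expr1 comp_polyXr.
have [T T1 defT] := IH _ (gauss_le_frob_poly e f1).
pose f' := frob_poly e f \Po 'X^x.
have f'1 : gauss_le 1 f' by apply/gauss_le_comp_Xn/gauss_le_frob_poly.
exists (fun k => if k is k'.+1 then T k' else f ^+ (x ^ s.+1) - f' ^+ (x ^ s)).
  case=> [|k] ks; last exact: T1.
  rewrite subn0 expnS exprM -expnM.
  apply: gauss_leW (gauss_le_subr_exp _ _ f'1 (gauss_le_exp_frob e f1)).
    by rewrite ler_wiXn2l // ltnS leq_pmull.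
  exact: gauss_le_exp.
rewrite big_ord_recl /= expn0 comp_polyXr.
suff -> : f' ^+ (x ^ s) =
    \sum_(k < s.+1) (T k \Po 'X^(x ^ bump 0 k)) by rewrite subrK.
rewrite -rmorphXn /= defT raddf_sum; apply: eq_bigr => k _ /=.
by rewrite comp_poly_XnM -expnS.
Qed.

(** * Decomposing the powers of [P] for Dwork's congruences *)

Section DworkDecomposition.
Variables (P : {poly F}) (N : nat -> nat).
Hypotheses (P1 : gauss_le 1 P) (N1_gt0 : (0 < N 1)%N).
Hypothesis N_split : forall k l, (k <= l)%N -> N l = (N k + x ^ k * N (l - k))%N.

Lemma exponent_gt0 k : (0 < k)%N -> (0 < N k)%N.
Proof. by move=> k0; rewrite (N_split k0) addn_gt0 N1_gt0. Qed.

(* Dwork's congruences, in the form of an induction principle: modulo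
   [rho ^+ s] the powers [P ^+ N l] are combinations of the products
   [P ^+ N i * T ('X^(x ^ i))] in which [T] is divisible by [rho ^+ (s - i)].
   One factor [P] is removed throughout, so that it may be replaced by
   [P / ('X - a)]. The index [maxn i 1] keeps that factor when [i = 0]. *)
Lemma dwork_ind (Q : {poly F} -> Prop) s :
  Q 0 -> (forall f h, Q f -> Q h -> Q (f + h)) ->
  (forall i T, (i <= s)%N -> gauss_le (rho ^+ (s - i)) T ->
     Q (P ^+ (N (maxn i 1)).-1 * (T \Po 'X^(x ^ i)))) ->
  forall k l T, (k <= s)%N -> (k <= l)%N -> (0 < l)%N ->
    gauss_le (rho ^+ (s - k)) T -> Q (P ^+ (N l).-1 * (T \Po 'X^(x ^ k))).
Proof.
move=> Q0 QD Qgen; elim/ltn_ind => k IH l T ks kl l0 Ts.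
(* For [k = 0] the surplus [P ^+ (N l - N 1)] is absorbed into [T]. *)
have [k0|k0] := posnP k.
  move: Ts; rewrite k0 expn0 comp_polyXr => Ts.
  have -> : P ^+ (N l).-1 * T =
      P ^+ (N (maxn 0 1)).-1 * ((P ^+ (N l - N 1) * T) \Po 'X^(x ^ 0)).
    rewrite expn0 comp_polyXr mulrA -exprD max0n; congr (P ^+ _ * _).
    by rewrite (N_split l0) addKn -!subn1 addnBAC.
  by apply: Qgen => //; apply: gauss_leM1 => //; apply: gauss_le_exp.
have [V V1 defV] := gauss_le_exp_decomp k (gauss_le_exp (N (l - k)) P1).
have -> : P ^+ (N l).-1 * (T \Po 'X^(x ^ k)) =
    \sum_(i < k.+1)
       P ^+ (N k).-1 * ((V i * (T \Po 'X^(x ^ (k - i)))) \Po 'X^(x ^ i)).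
  rewrite (N_split kl) -!subn1 -addnBAC ?exponent_gt0 // exprD mulnC exprM defV.
  rewrite -mulrA mulr_suml mulr_sumr; apply: eq_bigr => i _.
  by rewrite rmorphM /= comp_poly_XnM -expnD subnKC // -ltnS.
elim/big_rec: _ => // i f _; apply: QD.
have ik : (i <= k)%N by rewrite -ltnS.
have gi : gauss_le (rho ^+ (s - i)) (V i * (T \Po 'X^(x ^ (k - i)))).
  have -> : (s - i = (k - i) + (s - k))%N by rewrite addnC addnBA // subnK.
  rewrite exprD; apply: gauss_leM; first exact: V1.
  exact: gauss_le_comp_Xn.
(* The term [i = k] is a generator as it stands; the others have a smaller index and fall under the
   induction hypothesis. *)
move: ik; rewrite leq_eqVlt => /predU1P[eik|ik].
  have {1}-> : N k = N (maxn i 1) by rewrite eik (maxn_idPl k0).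
  by apply: Qgen => //; rewrite eik.
by apply: IH => //; [apply: leq_trans ks; apply: ltnW | apply: ltnW].
Qed.

End DworkDecomposition.
End Frobenius.
End NonarchimedeanAbsval.

(** * Hasse-Witt matrices *)

(** The factor in ['X^y] moves exponents by multiples of [y], so only the coefficients of [f] at
    exponents congruent to -1 modulo [y] contribute, as for the Cartier operator. The size bound
    leaves [g] of them. *)
Lemma coefM_comp_poly_Xn (K : fieldType) (f T : {poly K}) (y g M : nat) :
  (0 < y)%N -> (0 < M)%N -> (g <= M)%N -> (size f <= g.+1 * y - 1)%N ->
  (f * (T \Po 'X^y))`_(M * y - 1) =
    \sum_(w < g) f`_(w.+1 * y - 1) * T`_(M - w.+1).
Proof.
(* Coefficients of [T] from index [M] on only reach exponents at least [M * y], so [T] may be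
   truncated at [M]. *)
move=> y0 M0 gM sf; rewrite -{1}(poly_take_drop M T) rmorphD rmorphM /=.
rewrite comp_Xn_poly -exprM mulrDr coefD mulrA (mulnC y M) coefMXn.
rewrite ifT ?addr0; last by rewrite subn1 ltn_predL muln_gt0 M0.
rewrite /take_poly.
rewrite poly_def raddf_sum mulr_sumr coef_sum.
rewrite (big_ord_widen M (fun w => f`_(w.+1 * y - 1) * T`_(M - w.+1))) //.
rewrite (reindex_inj rev_ord_inj) /= big_mkcond [RHS]big_mkcond /=.
apply: eq_bigr => w _; rewrite comp_polyZ comp_Xn_poly -exprM -scalerAr coefZ.
rewrite coefMXn (mulnC y); have wM := ltn_ord w.
have -> : (M * y - 1 < (M - w.+1) * y)%N = false.
  by apply/negbTE; rewrite -leqNgt mulnBl; lia.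
have -> : (M * y - 1 - (M - w.+1) * y = w.+1 * y - 1)%N.
  by rewrite mulnBl; have := leq_mul wM (leqnn y); lia.
case: ltnP => gw; first by rewrite mulrC.
rewrite [f`__]nth_default ?mulr0 //; apply: leq_trans sf _.
by rewrite leq_sub2r // leq_mul2r ltnS gw orbT.
Qed.

(** * Arithmetic of the exponents N_s *)

Section Exponents.
Variables p q e g : nat.
Hypotheses (p_gt0 : (0 < p)%N) (q_gt0 : (0 < q)%N) (pe1 : (p ^ e = 1 %[mod q])%N).
Hypothesis lt_pe : (g * q + 1 < p ^ e)%N.
Local Notation x := (p ^ e)%N.
Definition Phi_exp s := ((p ^ (e * s) - 1) %/ q)%N.

Lemma mul_Phi_exp s : (q * Phi_exp s = x ^ s - 1)%N.
Proof.
rewrite /Phi_exp expnM mulnC divnK // -eqn_mod_dvd ?expn_gt0 ?p_gt0 //.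
by rewrite -modnXm pe1 modnXm exp1n.
Qed.

Lemma mul_Phi_expS s : ((q * Phi_exp s).+1 = x ^ s)%N.
Proof. by rewrite mul_Phi_exp subn1 prednK // !expn_gt0 p_gt0. Qed.

(** Since [q * Phi_exp s + 1 = x ^ s], this is the identity [x ^ l = x ^ k * x ^ (l - k)]. *)
Lemma Phi_exp_split k l : (k <= l)%N ->
  Phi_exp l = (Phi_exp k + x ^ k * Phi_exp (l - k))%N.
Proof.
move=> kl; apply/eqP; rewrite -(eqn_pmul2l q_gt0) -eqSS mul_Phi_expS.
rewrite mulnDr -addSn mul_Phi_expS mulnCA -mulnS mul_Phi_expS -expnD.
by rewrite subnKC.
Qed.

Lemma Phi_exp1_gt0 : (0 < g)%N -> (0 < Phi_exp 1)%N.
Proof.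
move=> g0; rewrite lt0n; apply: contraTneq lt_pe => N0.
rewrite -leqNgt -[x]expn1 -mul_Phi_expS N0 muln0.
by rewrite addn1.
Qed.

Lemma leq_expx s : (0 < s)%N -> (x <= x ^ s)%N.
Proof. by move=> s0; rewrite -{1}[x]expn1 leq_pexp2l ?expn_gt0 ?p_gt0. Qed.

(** With n = [g * q + 1], the left side bounds the size of P^(N_s - 1) f when [f] has size at most n
    + g. The exponent [g.+1 * x ^ s - 1] is then out of reach, and [g] columns suffice. *)
Lemma size_bound s : ((g * q + 1) * Phi_exp s + g <= g.+1 * x ^ s - 1)%N.
Proof.
rewrite -mul_Phi_expS; have := leq_pmull (Phi_exp s) q_gt0; clear lt_pe; nia.
Qed.
End Exponents.

Lemma mxBE (V : zmodType) k l (A B : 'M[V]_(k, l)) i j :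
  (A - B) i j = A i j - B i j.
Proof. by rewrite mxE [X in _ + X]mxE. Qed.

(** * Determinants modulo p *)

Section DeterminantCongruences.
Variables (R : realType) (F : fieldType) (norm : F -> R).
Hypothesis normP : nonarch_absval norm.

Lemma nabs_det_sub_le k (A B : 'M[F]_k) r : 0 <= r ->
  (forall i j, norm (A i j) <= 1) -> (forall i j, norm (B i j) <= 1) ->
  (forall i j, norm (A i j - B i j) <= r) -> norm (\det A - \det B) <= r.
Proof.
move=> r0 A1 B1 AB; rewrite /determinant -sumrB nabs_sum_le // => s _.
rewrite -mulrBr nabsM1_le // ?nabsX ?nabsN ?nabs1 ?expr1n //.
(* The factors are exchanged one at a time; integrality of both products is carried along because
   the exchange uses it. *)
suff [_ _] : [/\ norm (\prod_i A i (s i)) <= 1, norm (\prod_i B i (s i)) <= 1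
    & norm (\prod_i A i (s i) - \prod_i B i (s i)) <= r] by [].
elim/big_ind2: _ => [|b a d c [a1 b1 ab] [c1 d1 cd]|i _]; last by split.
  by rewrite subrr nabs0 // nabs1.
split; [exact: nabsM1_le | exact: nabsM1_le |].
have -> : a * c - b * d = c * (a - b) + b * (c - d) by ring.
by rewrite nabsD_le // nabsM1_le.
Qed.

Variables (p e : nat).
Hypotheses (p_prime : prime p) (np_lt1 : norm p%:R < 1).

Lemma nabs_exp_sum (I : Type) (s : seq I) (P : pred I) (f : I -> F) k :
  (forall i, P i -> norm (f i) <= 1) ->
  norm ((\sum_(i <- s | P i) f i) ^+ (p ^ k) - \sum_(i <- s | P i) f i ^+ (p ^ k))
    <= norm p%:R.
Proof.
move=> f1; have /(_ 0%N) := gauss_le_exp_sum normP p_prime s k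
  (fun i Pi => gauss_leC normP (f1 i Pi)).
rewrite -rmorph_sum -rmorphXn /=.
under [in X in _ - X]eq_bigr do rewrite -rmorphXn.
by rewrite -rmorph_sum -rmorphB coefC.
Qed.

Lemma nabs_det_frob k (A : 'M[F]_k) : odd p ->
  (forall i j, norm (A i j) <= 1) ->
  norm (\det (map_mx (fun y => y ^+ (p ^ e)) A) - \det A ^+ (p ^ e)) <= norm p%:R.
Proof.
move=> p_odd A1; rewrite -[_ - _]opprB nabsN //.
have -> : \det (map_mx (fun y => y ^+ (p ^ e)) A) =
    \sum_(s : 'S_k) ((-1) ^+ s * \prod_i A i (s i)) ^+ (p ^ e).
  (* Oddness of [p] lets the signs of the Leibniz expansion survive the power [p ^ e]. *)
  apply: eq_bigr => s _; rewrite exprMn -exprM mulnC exprM.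
  rewrite -[(-1) ^+ (p ^ e)]signr_odd oddX p_odd orbT expr1 -prodrXl.
  by congr (_ * _); apply: eq_bigr => i _; rewrite mxE.
apply: nabs_exp_sum => s _; rewrite nabsM1_le ?nabsX ?nabsN ?nabs1 ?expr1n //.
by rewrite nabs_prod // prodr_ile1 // => i _; rewrite (absval_ge0 normP) A1.
Qed.

End DeterminantCongruences.

(** * The matrices A_s and I_s at an integral point *)

Section HasseWitt.
Variables (R : realType) (K : fieldType) (norm : K -> R).
Hypothesis normP : nonarch_absval norm.
Variables p q e g n : nat.
Hypotheses (p_prime : prime p) (p_odd : odd p) (np_lt1 : norm p%:R < 1).
Hypotheses (q_gt0 : (0 < q)%N) (pe1 : (p ^ e = 1 %[mod q])%N).
Hypotheses (def_n : n = (g * q + 1)%N) (lt_n_pe : (n < p ^ e)%N).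
Hypotheses (e_gt0 : (0 < e)%N) (g_gt0 : (0 < g)%N).
Variable a : 'I_n -> K.
Hypothesis a1 : forall i, norm (a i) <= 1.

Local Notation x := (p ^ e)%N.
Local Notation rho := (norm p%:R).
Local Notation N := (Phi_exp p q e).

Definition root_poly : {poly K} := \prod_i ('X - (a i)%:P).
Definition root_cofactor i : {poly K} := \prod_(j | j != i) ('X - (a j)%:P).
Local Notation P := root_poly.
Local Notation A s := (Amx p q e s g a).
Local Notation I s := (Imx p q e s g a).
Local Notation J s := (I s *m invmx (A s)).

Let p_gt0 := prime_gt0 p_prime.
Let lt_pe : (g * q + 1 < x)%N. Proof. by rewrite -def_n. Qed.
Let rho_ge0 : 0 <= rho. Proof. exact: absval_ge0 normP _. Qed.
Let rho_le1 : rho <= 1. Proof. exact: ltW. Qed.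
Let N_gt0 s : (0 < s)%N -> (0 < N s)%N.
Proof.
apply: exponent_gt0; first exact: (Phi_exp1_gt0 p_gt0 pe1 lt_pe g_gt0).
exact: Phi_exp_split.
Qed.

Lemma leq_gx s : (0 < s)%N -> (g <= x ^ s)%N.
Proof.
move=> s0; apply: leq_trans _ (leq_expx e p_gt0 s0).
apply: leq_trans _ (ltnW lt_pe).
by rewrite addn1 leqW // leq_pmulr.
Qed.

Lemma root_polyE i : P = root_cofactor i * ('X - (a i)%:P).
Proof. by rewrite /P (bigD1 i) //= mulrC. Qed.

Lemma size_root_poly : size P = n.+1.
Proof.
by rewrite size_prod_XsubC [index_enum _]unlock -enumT size_enum_ord.
Qed.

Lemma gauss_le_root_poly : gauss_le norm 1 P.
Proof. by apply: gauss_le_prod => // i _; apply: gauss_le_XsubC. Qed.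

Lemma gauss_le_root_cofactor i : gauss_le norm 1 (root_cofactor i).
Proof. by apply: gauss_le_prod => // j _; apply: gauss_le_XsubC. Qed.

Lemma size_root_cofactor i : (size (root_cofactor i) <= n)%N.
Proof.
have := size_root_poly; rewrite (root_polyE i) size_Mmonic ?monicXsubC //.
  by rewrite size_XsubC addn2 => -[->].
apply: contra_eq_neq size_root_poly => c0.
by rewrite (root_polyE i) c0 mul0r size_poly0.
Qed.

(** Multiplication by ['X^u] moves the exponent to [v.+1 * x ^ s - 1], the kind that also occurs in
    [I s]. Entries of both matrices thus become coefficients of [P ^+ (N s).-1] times a polynomial
    of size at most [n + g]. *)
Lemma AmxE s u v : (0 < s)%N ->
  A s u v = (P ^+ (N s).-1 * (P * 'X^u))`_(v.+1 * x ^ s - 1).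
Proof.
move=> s0; rewrite mxE /Phi -/P mulrA -exprSr prednK ?N_gt0 // coefMXn.
have := leq_gx s0; have := ltn_ord u => ug gx.
rewrite ifN; last by rewrite -leqNgt mulSn; lia.
by congr (_`_ _); rewrite expnM mulnC; lia.
Qed.

Lemma ImxE s i l : (0 < s)%N ->
  I s i l = (P ^+ (N s).-1 * root_cofactor i)`_(l.+1 * x ^ s - 1).
Proof.
move=> s0; rewrite mxE /Phi -/P -/(N s) -{1}(prednK (N_gt0 s0)) exprSr.
rewrite {2}(root_polyE i) mulrA mulpK ?polyXsubC_eq0 //.
by rewrite expnM.
Qed.

(** For [f] equal to [root_cofactor i] or to [P * 'X^u] the sum is a row of [I s] or [A s] times one
    and the same column, made of coefficients of [T]. *)
Lemma coef_power_comp s (f T : {poly K}) M : (0 < s)%N -> (size f <= n + g)%N ->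
  (g <= M)%N ->
  (P ^+ (N s).-1 * (T \Po 'X^(x ^ s)) * f)`_(M * x ^ s - 1) =
    \sum_(w < g) (P ^+ (N s).-1 * f)`_(w.+1 * x ^ s - 1) * T`_(M - w.+1).
Proof.
move=> s0 sf gM; rewrite mulrAC (@coefM_comp_poly_Xn _ _ _ _ g) //.
- by rewrite !expn_gt0 p_gt0.
- exact: leq_trans g_gt0 gM.
apply: leq_trans _ (size_bound g p_gt0 q_gt0 pe1 s).
apply: leq_trans (size_polyMleq _ _) _.
have sP := size_poly_exp_leq P (N s).-1.
rewrite size_root_poly in sP; rewrite -subn1.
apply: leq_trans (leq_sub2r 1 (leq_add sP sf)) _.
rewrite -def_n -[in (n * N s)%N](prednK (N_gt0 s0)) mulnS addSn subn1 /=.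
by rewrite addnA [(_ + n)%N]addnC.
Qed.

Lemma nabs_Amx s u v : (0 < s)%N -> norm (A s u v) <= 1.
Proof.
move=> s0; rewrite AmxE //; apply: gauss_leM1 => //.
  exact/gauss_le_exp/gauss_le_root_poly.
by apply: gauss_leM1 => //; [exact: gauss_le_root_poly | exact: gauss_leXn].
Qed.

Lemma nabs_Imx s i l : (0 < s)%N -> norm (I s i l) <= 1.
Proof.
move=> s0; rewrite ImxE //; apply: gauss_leM1 => //.
  exact/gauss_le_exp/gauss_le_root_poly.
exact: gauss_le_root_cofactor.
Qed.

Lemma size_root_polyMXn u : (u < g)%N -> (size (P * 'X^u)%R <= n + g)%N.
Proof.
move=> ug; apply: leq_trans (size_polyMleq _ _) _.
by rewrite size_root_poly size_polyXn addnS addSn /= -addnS leq_add2l.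
Qed.

(** As [N s.+1 = N 1 + x * N s], the factor [(P ^+ N s) ^+ x] can be replaced modulo p by a
    polynomial in ['X^x] whose coefficients are the x-th powers of those of [P ^+ N s]. *)
Lemma Amx_frob s u v : (0 < s)%N ->
  norm (A s.+1 u v - (A 1 *m map_mx (fun y => y ^+ x) (A s)) u v) <= rho.
Proof.
move=> s0; rewrite [(_ *m _) u v]mxE AmxE //.
have P1 k : gauss_le norm 1 (P ^+ k) by apply/gauss_le_exp/gauss_le_root_poly.
pose T := frob_poly p e (P ^+ N s).
have -> : \sum_w A 1 u w * (map_mx (fun y => y ^+ x) (A s)) w v =
    (P ^+ (N 1).-1 * (T \Po 'X^x) * (P * 'X^u))`_(v.+1 * x ^ s.+1 - 1).
  have gM : (g <= v.+1 * x ^ s)%N by rewrite (leq_trans (leq_gx s0)) ?leq_pmull.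
  rewrite expnSr mulnA -{2 3}(expn1 x) coef_power_comp ?size_root_polyMXn //.
  apply: eq_bigr => w _; rewrite AmxE // /T coef_frob_poly // !mxE.
  by rewrite /Phi -/P -/(N s) expnM [(_ * v.+1)%N]mulnC.
rewrite -coefB -mulrBl mulrC; apply: gauss_leM1 => //.
  by apply: gauss_leM1; [| exact: gauss_le_root_poly | exact: gauss_leXn].
have -> : P ^+ (N s.+1).-1 = P ^+ (N 1).-1 * (P ^+ N s) ^+ x.
  rewrite (Phi_exp_split p_gt0 q_gt0 pe1 (ltn0Sn s)) expn1 subSS subn0.
  by rewrite -exprM -exprD [(N s * x)%N]mulnC -!subn1 addnBAC ?N_gt0.
by rewrite -mulrBr; apply: gauss_leM1 => //; apply: gauss_le_exp_frob.
Qed.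

Hypothesis detA1 : norm (\det (A 1)) = 1.

(** By the recursion modulo p, [\det (A s.+1)] is congruent to [\det (A 1) * \det (A s) ^+ x], a
    unit by induction. *)
Lemma nabs_det_Amx s : (0 < s)%N -> norm (\det (A s)) = 1.
Proof.
elim: s => // s IH _; have [->//|s0] := posnP s.
have fA i j : norm (map_mx (fun y => y ^+ x) (A s) i j) <= 1.
  by rewrite mxE nabsX // exprn_ile1 ?(absval_ge0 normP) // nabs_Amx.
apply: (@nabs_eq1 _ _ _ normP _ (\det (A 1) * \det (A s) ^+ x)).
  by rewrite (absvalM normP) detA1 mul1r nabsX // IH // expr1n.
apply: le_lt_trans np_lt1.
rewrite -(subrKA (\det (A 1 *m map_mx (fun y => y ^+ x) (A s)))) nabsD_le //.
  apply: nabs_det_sub_le => //; [by move=> *; exact: nabs_Amx | | ].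
    move=> i j; rewrite -[1]mulr1; apply: nabs_mulmx_le => // k.
    exact: nabs_Amx.
  by move=> i j; apply: Amx_frob.
rewrite det_mulmx -mulrBr nabsM1_le ?detA1 //; apply: nabs_det_frob => //.
by move=> i j; apply: nabs_Amx.
Qed.

Lemma Amx_unit s : (0 < s)%N -> A s \in unitmx.
Proof.
move=> s0; rewrite unitmxE unitfE; apply: contra_eq_neq (nabs_det_Amx s0) => ->.
by rewrite nabs0 // eq_sym oner_eq0.
Qed.

Lemma nabs_invAmx s u v : (0 < s)%N -> norm (invmx (A s) u v) <= 1.
Proof.
move=> s0; apply: nabs_invmx_le1 => //; last exact: nabs_det_Amx.
by move=> *; apply: nabs_Amx.
Qed.

Lemma nabs_Jmx s i l : (0 < s)%N -> norm (J s i l) <= 1.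
Proof.
move=> s0; rewrite -[1]mulr1; apply: nabs_mulmx_le => //.
  by move=> k; apply: nabs_Imx.
by move=> k j; apply: nabs_invAmx.
Qed.

(** The inverse of [A s.+1] being integral, it suffices to compare [I s.+1] with [J s *m A s.+1]. On
    a Dwork generator of index [k > 0] the difference is [(J k - J s) *m (A k *m b)]: the first
    factor gives [rho ^+ k], and [b] gives [rho ^+ (s - k)]. *)
Lemma Jmx_step s : (0 < s)%N ->
  (forall k i l, (0 < k <= s)%N -> norm (J s i l - J k i l) <= rho ^+ k) ->
  forall i l, norm (J s.+1 i l - J s i l) <= rho ^+ s.
Proof.
move=> s0 IH.
suff Q i l : norm ((I s.+1 - J s *m A s.+1) i l) <= rho ^+ s.
  move=> i l; have -> : J s.+1 i l - J s i l = (J s.+1 - J s) i l by rewrite mxBE.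
  rewrite -[X in _ - X](mulmxK (Amx_unit (ltn0Sn s))) -mulmxBl -[rho ^+ s]mulr1.
  apply: nabs_mulmx_le => //; first exact: exprn_ge0.
  by move=> k j; apply: nabs_invAmx.
pose M := (l.+1 * x ^ s.+1 - 1)%N.
pose Q f := norm ((f * root_cofactor i)`_M
                  - \sum_u J s i u * (f * (P * 'X^u))`_M) <= rho ^+ s.
have rs0 : 0 <= rho ^+ s by apply: exprn_ge0.
have Q0 : Q 0.
  rewrite /Q mul0r coef0 big1 ?subrr ?nabs0 // => u _.
  by rewrite mul0r coef0 mulr0.
have QD f h : Q f -> Q h -> Q (f + h).
  rewrite /Q => Qf Qh; rewrite mulrDl coefD.
  under eq_bigr do rewrite mulrDl coefD mulrDr.
  by rewrite big_split opprD addrACA nabsD_le.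
have Qgen k T : (k <= s)%N -> gauss_le norm (rho ^+ (s - k)) T ->
    Q (P ^+ (N (maxn k 1)).-1 * (T \Po 'X^(x ^ k))).
  (* A generator of index 0 has Gauss norm at most [rho ^+ s] already. *)
  move=> ks Ts; have [k0|k0] := posnP k.
    move: Ts; rewrite k0 subn0 => Ts.
    have hs : gauss_le norm (rho ^+ s)
        (P ^+ (N (maxn 0 1)).-1 * (T \Po 'X^(x ^ 0))).
      apply: gauss_leM1 => //; first exact/gauss_le_exp/gauss_le_root_poly.
      exact: gauss_le_comp_Xn.
    rewrite /Q nabsB_le //.
      by rewrite mulrC; apply: gauss_leM1 => //; apply: gauss_le_root_cofactor.
    apply: nabs_sum_le => // u _; apply: nabsM1_le; rewrite ?nabs_Jmx //.
    rewrite mulrC; apply: gauss_leM1 => //; apply: gauss_leM1 => //.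
      exact: gauss_le_root_poly.
    exact: gauss_leXn.
  rewrite (maxn_idPl k0) /Q.
  have defM : M = (l.+1 * x ^ (s.+1 - k) * x ^ k - 1)%N.
    by rewrite -mulnA -expnD subnK // leqW.
  have gM : (g <= l.+1 * x ^ (s.+1 - k))%N.
    by rewrite (leq_trans (leq_gx _) (leq_pmull _ _)) // subn_gt0 ltnS.
  pose b := \col_(w < g) T`_(l.+1 * x ^ (s.+1 - k) - w.+1).
  have -> : (P ^+ (N k).-1 * (T \Po 'X^(x ^ k)) * root_cofactor i)`_M =
      (I k *m b) i 0.
    rewrite defM coef_power_comp //; last first.
      by rewrite (leq_trans (size_root_cofactor i)) ?leq_addr.
    by rewrite mxE; apply: eq_bigr => w _; rewrite ImxE // [b _ _]mxE.
  have -> : \sum_u J s i u * (P ^+ (N k).-1 * (T \Po 'X^(x ^ k)) * (P * 'X^u))`_M =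
      (J s *m (A k *m b)) i 0.
    rewrite [RHS]mxE; apply: eq_bigr => u _; congr (_ * _).
    rewrite defM coef_power_comp ?size_root_polyMXn //.
    by rewrite mxE; apply: eq_bigr => w _; rewrite AmxE // [b _ _]mxE.
  rewrite -[I k](mulmxKV (Amx_unit k0)) -[_ *m A k *m b]mulmxA.
  have -> (B C : 'M[K]_(n, 1)) : B i 0 - C i 0 = (B - C) i 0 by rewrite mxBE.
  have -> : rho ^+ s = rho ^+ k * rho ^+ (s - k) by rewrite -exprD subnKC.
  rewrite -mulmxBl; apply: nabs_mulmx_le; rewrite ?exprn_ge0 //.
    move=> j; rewrite mxBE -nabsN // opprB.
    by rewrite IH // k0.
  move=> u j; rewrite -[rho ^+ _]mul1r; apply: nabs_mulmx_le => //.
  - exact: exprn_ge0.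
  - by move=> w; apply: nabs_Amx.
  - by move=> w z; rewrite mxE.
(* The power [P ^+ (N s.+1).-1] itself is the case [k = s], [l = s.+1], [T = 1]. *)
have := dwork_ind normP p_prime np_lt1 e_gt0 gauss_le_root_poly
  (N_gt0 (ltn0Sn 0)) (Phi_exp_split p_gt0 q_gt0 pe1) Q0 QD Qgen
  (leqnn s) (leqnSn s) (ltn0Sn s).
rewrite subnn expr0 => /(_ _ (gauss_le1 normP)).
rewrite /Q rmorph1 mulr1 mxBE [(_ *m A _) i l]mxE ImxE //.
congr (norm (_ - _) <= _); apply: eq_bigr => u _.
by rewrite AmxE.
Qed.

Lemma Jmx_congr s k i l : (0 < k <= s)%N ->
  norm (J s i l - J k i l) <= rho ^+ k.
Proof.
elim: s k i l => [|s IH] k i l; first by case: k.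
case/andP=> k0; rewrite leq_eqVlt => /predU1P[->|].
  by rewrite subrr nabs0 // exprn_ge0.
rewrite ltnS => ks; have s0 := leq_trans k0 ks.
rewrite -(subrKA (J s i l)) nabsD_le //; last by rewrite IH // k0.
apply: le_trans (Jmx_step s0 IH i l) _.
by rewrite ler_wiXn2l.
Qed.

(** * The functional lambda and the estimate behind the rank *)

Definition coef_functional s (y : 'cV[K]_g) (f : {poly K}) : K :=
  \sum_l y l 0 * (P ^+ (N s).-1 * f)`_(l.+1 * x ^ s - 1).

Lemma coef_functional_sum s y (T : Type) (r : seq T) (b : T -> K)
    (f : T -> {poly K}) :
  coef_functional s y (\sum_(i <- r) b i *: f i) =
    \sum_(i <- r) b i * coef_functional s y (f i).
Proof.
rewrite /coef_functional; under [RHS]eq_bigr do rewrite mulr_sumr.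
rewrite exchange_big; apply: eq_bigr => l _ /=.
rewrite mulr_sumr coef_sum mulr_sumr; apply: eq_bigr => i _.
by rewrite -scalerAr coefZ mulrCA.
Qed.

Lemma coef_functional_cofactor s y i : (0 < s)%N ->
  coef_functional s y (root_cofactor i) = (I s *m y) i 0.
Proof.
by move=> s0; rewrite mxE; apply: eq_bigr => l _; rewrite ImxE // mulrC.
Qed.

Lemma coef_functional_root_poly s y (u : 'I_g) : (0 < s)%N ->
  coef_functional s y (P * 'X^u) = (A s *m y) u 0.
Proof.
by move=> s0; rewrite mxE; apply: eq_bigr => l _; rewrite AmxE // mulrC.
Qed.

Lemma horner_root_cofactor i z :
  (root_cofactor i).[z] = \prod_(j | j != i) (z - a j).
Proof. by rewrite horner_prod; apply: eq_bigr => j _; rewrite hornerXsubC. Qed.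

(** Lagrange interpolation: the difference has degree below [n] and vanishes at the [n] distinct
    points [a i]. *)
Lemma lagrange_root_cofactor (f : {poly K}) : injective a -> (size f <= n)%N ->
  f = \sum_i (f.[a i] / (root_cofactor i).[a i]) *: root_cofactor i.
Proof.
move=> a_inj sf; apply/eqP; rewrite -subr_eq0; apply/eqP.
apply: (@roots_geq_poly_eq0 _ _ [seq a i | i <- enum 'I_n]).
- apply/allP => _ /mapP[j _ ->]; rewrite rootE hornerD hornerN horner_sum.
  rewrite (bigD1 j) //= big1 => [|i ij]; last first.
    rewrite hornerZ [(root_cofactor i).[a j]]horner_root_cofactor.
    by rewrite (bigD1 j) 1?eq_sym //= subrr mul0r mulr0.
  rewrite hornerZ divfK ?addr0 ?subrr // horner_root_cofactor.
  apply/prodf_neq0 => i ij; rewrite subr_eq0.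
  by apply: contra_neq ij => /a_inj.
- by rewrite map_inj_uniq ?enum_uniq.
rewrite size_map size_enum_ord; apply: leq_trans (size_polyD _ _) _.
rewrite geq_max sf size_polyN; apply: leq_trans (size_sum _ _ _) _.
apply/bigmax_leqP => i _; apply: leq_trans (size_scale_leq _ _) _.
exact: size_root_cofactor.
Qed.

(* The logarithmic derivative of [P ^+ N s * 'X^k], times [P * 'X^k]. *)
Definition exact_poly s k : {poly K} :=
  (N s)%:R *: (P^`() * 'X^k) + k%:R *: (P * 'X^(k.-1)).

Lemma exact_polyE s k : (0 < s)%N ->
  P ^+ (N s).-1 * exact_poly s k = (P ^+ N s * 'X^k)^`().
Proof.
move=> s0; rewrite derivM deriv_exp derivXn /exact_poly !scaler_nat mulrDr.
congr (_ + _); first by rewrite mulrnAr mulrnAl mulrA [_ * P^`()]mulrC.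
by rewrite !mulrnAr mulrA -exprSr prednK ?N_gt0.
Qed.

(** In a derivative the coefficient at exponent [l.+1 * x ^ s - 1] carries the factor
    [l.+1 * x ^ s]. *)
Lemma nabs_coef_functional_exact s k (y : 'cV[K]_g) r : (0 < s)%N ->
  (forall l, norm (y l 0) <= r) ->
  norm (coef_functional s y (exact_poly s k)) <= r * rho ^+ s.
Proof.
move=> s0 yr; have r0 : 0 <= r.
  exact: le_trans (absval_ge0 normP _) (yr (Ordinal g_gt0)).
apply: nabs_sum_le => // [|l _]; first by rewrite mulr_ge0 ?exprn_ge0.
apply: nabsM_le => //; rewrite exact_polyE // coef_deriv.
have -> : (l.+1 * x ^ s - 1).+1 = (l.+1 * x ^ s)%N.
  by rewrite subn1 prednK // muln_gt0 !expn_gt0 p_gt0.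
rewrite -[_ *+ (_ * _)]mulr_natr; apply: nabsM1_le => //.
  apply: gauss_leM1 => //; first exact/gauss_le_exp/gauss_le_root_poly.
  exact: gauss_leXn.
rewrite natrM; apply: nabsM1_le => //; first exact: nabs_nat.
rewrite -expnM natrX nabsX // ler_wiXn2l //.
exact: leq_pmull.
Qed.

Lemma gauss_le_exact_poly s k : gauss_le norm 1 (exact_poly s k).
Proof.
have Z1 c f : gauss_le norm 1 f -> gauss_le norm 1 (c%:R *: f : {poly K}).
  by move=> f1 i; rewrite coefZ nabsM1_le ?nabs_nat.
apply: gauss_leD => //; apply: Z1; apply: gauss_leM1 => //.
- by move=> i; rewrite coef_deriv -mulr_natr nabsM1_le ?nabs_nat ?gauss_le_root_poly.
- exact: gauss_leXn.
- exact: gauss_le_root_poly.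
- exact: gauss_leXn.
Qed.

Lemma coef_exact_poly s k j :
  (exact_poly s k.+1)`_(j + k) = (N s * j + k.+1)%:R * P`_j.
Proof.
rewrite coefD !coefZ !coefMXn natrD mulrDl natrM; congr (_ + _); last first.
  by rewrite ltnNge leq_addl /= addnK.
case: j => [|j]; first by rewrite add0n ltnSn !(mulr0, mul0r).
rewrite addSnnS ltnNge leq_addl /= addnK coef_deriv -[_ *+ j.+1]mulr_natr.
by rewrite -mulrA [_ * P`__]mulrC.
Qed.

Lemma exact_poly_lead s k : exact_poly s k.+1 =
  \sum_(j < n + k) (exact_poly s k.+1)`_j *: 'X^j + (N s * n + k.+1)%:R *: 'X^(n + k).
Proof.
have lead1 : P`_n = 1.
  have := monic_prod_XsubC (index_enum 'I_n) predT a.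
  by rewrite monicE /lead_coef -/P size_root_poly => /eqP.
have -> : (N s * n + k.+1)%:R = (exact_poly s k.+1)`_(n + k).
  by rewrite coef_exact_poly lead1 mulr1.
rewrite -(big_ord_recr (n + k) (fun j => (exact_poly s k.+1)`_j *: 'X^j)).
rewrite -poly_def; apply/polyP => j; rewrite coef_poly; case: ltnP => // nkj.
have [i def_j] : exists i, j = (i + k)%N.
  by exists (j - k)%N; rewrite subnK // (leq_trans _ nkj) // leqW // leq_addl.
rewrite def_j in nkj *.
rewrite coef_exact_poly nth_default ?mulr0 // size_root_poly.
by rewrite -(ltn_add2r k).
Qed.

Hypothesis lt_nq_p : (n - q < p)%N.

Lemma nabs_exact_lead s k : (0 < s)%N -> (k < g)%N -> norm (N s * n + k.+1)%:R = 1.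
Proof.
move=> s0 kg; apply: (nabs_coprime normP p_prime np_lt1); apply/negP => pdvd.
have : (p %| q * (g - k.+1) + 1)%N.
  have e1 : (q * (N s * n + k.+1) + (q * (g - k.+1) + 1) = x ^ s * n)%N.
    rewrite -(mul_Phi_expS p_gt0 pe1) mulSn def_n mulnDr mulnBr mulnA.
    by have := leq_mul (leqnn q) kg; lia.
  rewrite -(dvdn_addr _ (dvdn_mull q pdvd)) e1 dvdn_mulr // -expnM.
  by rewrite dvdn_exp // muln_gt0 e_gt0.
(* This multiple of [p] is positive and at most [n - q], its value for [k = 0], hence below [p]. *)
move/(dvdn_leq _); rewrite addn1 => /(_ isT); move: lt_nq_p.
rewrite def_n mulnBr mulnS; have := leq_mul (leqnn q) kg; lia.
Qed.

Section FunctionalBound.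
Variables (s : nat) (y : 'cV[K]_g) (r D C : R).
Hypotheses (s_gt0 : (0 < s)%N) (a_inj : injective a) (C_ge1 : 1 <= C).
Hypothesis C_cof : forall i, norm ((root_cofactor i).[a i])^-1 <= C.
Hypothesis y_le : forall l, norm (y l 0) <= D.
Hypothesis Iy_le : forall i, norm ((I s *m y) i 0) <= r.
(** The two sources of error: [r] on the root cofactors, [D * rho ^+ s] on the exact polynomials. *)
Let eta := Num.max r (D * rho ^+ s).

(** Strong induction on the degree. Below [n], interpolation costs the factor [C]. From [n] on, the
    monomial is solved from [exact_poly s k.+1], whose unit leading coefficient and integral lower
    ones cost nothing, so the constant does not grow. *)
Lemma nabs_coef_functional_Xn j : (j < n + g)%N ->
  norm (coef_functional s y 'X^j) <= C * eta.
Proof.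
have C0 : 0 <= C by apply: le_trans C_ge1.
have eta0 : 0 <= eta.
  rewrite le_max mulr_ge0 ?orbT ?exprn_ge0 //.
  exact: le_trans (absval_ge0 normP _) (y_le (Ordinal g_gt0)).
have eta_C : eta <= C * eta by rewrite ler_peMl.
elim/ltn_ind: j => j IH jng; case: (ltnP j n) => jn.
  rewrite (lagrange_root_cofactor a_inj (_ : size 'X^j <= n)%N) ?size_polyXn //.
  rewrite coef_functional_sum; apply: (nabs_sum_le normP) => [|i _].
    exact: mulr_ge0 C0 eta0.
  rewrite coef_functional_cofactor //; apply: nabsM_le => //; last first.
    by rewrite le_max Iy_le.
  by apply: nabsM1_le; rewrite // hornerXn nabsX // exprn_ile1 ?(absval_ge0 normP).
move: IH jng; rewrite -(subnKC jn) ltn_add2l; move: (j - n)%N => k IH kg.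
have U1 := nabs_exact_lead s_gt0 kg; set U := (_ + _)%:R in U1.
have U0 : U != 0.
  by apply: contra_eq_neq U1 => ->; rewrite nabs0 // eq_sym oner_eq0.
pose E := exact_poly s k.+1.
(* The two terms are indexed by booleans so that [coef_functional_sum] applies. *)
have defX : 'X^(n + k) =
    \sum_(i <- [:: true; false]) (if i then U^-1 else - U^-1) *:
       (if i then E else \sum_(j < n + k) E`_j *: 'X^j).
  rewrite !big_cons big_nil addr0 scaleNr -scalerBr {1}/E exact_poly_lead.
  by rewrite addrAC subrr add0r scalerA mulVf // scale1r.
rewrite defX coef_functional_sum; apply: (nabs_sum_le normP) => [|b _].
  exact: mulr_ge0 C0 eta0.
apply: nabsM1_le => //; first by case: b; rewrite ?nabsN // nabsV // U1 invr1.
case: b.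
  apply: le_trans eta_C; rewrite le_max orbC nabs_coef_functional_exact //.
rewrite coef_functional_sum; apply: (nabs_sum_le normP) => [|i _].
  exact: mulr_ge0 C0 eta0.
apply: nabsM1_le => //; first exact: gauss_le_exact_poly.
by apply: IH; rewrite // (ltn_trans (ltn_ord i)) // ltn_add2l.
Qed.

Lemma nabs_Amx_mul u : norm ((A s *m y) u 0) <= C * eta.
Proof.
rewrite -coef_functional_root_poly //.
have -> : P * 'X^u = \sum_(i < n + g) (P * 'X^u)`_i *: 'X^i.
  rewrite -poly_def; apply/polyP => i; rewrite coef_poly; case: ltnP => // ngi.
  by rewrite nth_default // (leq_trans (size_root_polyMXn _)).
rewrite coef_functional_sum; apply: (nabs_sum_le normP) => [|i _].
  exact: le_trans (absval_ge0 normP _) (nabs_coef_functional_Xn (ltn_addl n g_gt0)).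
apply: nabsM1_le => //; last exact: nabs_coef_functional_Xn.
by apply: gauss_leM1 => //; [exact: gauss_le_root_poly | exact: gauss_leXn].
Qed.

End FunctionalBound.

End HasseWitt.

(** * Completeness and the limit *)

Section FiniteExtensionComplete.
Variables (R : realType) (F : fieldType) (abs : F -> R).
Variables (L : fieldExtType F) (norm : L -> R).
Hypotheses (normP : nonarch_absval norm) (norm_abs : forall c, norm c%:A = abs c).
Hypothesis abs_complete : forall u : nat -> F, cauchy_for abs u ->
  exists l : F, converges_to abs u l.

Let normZ c v : norm (c *: v) = abs c * norm v.
Proof. by rewrite -[c *: v]mul1r -scalerAr scalerAl (absvalM normP) norm_abs. Qed.

Let abs_ge0 c : 0 <= abs c.
Proof. by rewrite -norm_abs (absval_ge0 normP). Qed.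

Lemma converges_toD (u v : nat -> L) l k : converges_to norm u l ->
  converges_to norm v k -> converges_to norm (fun i => u i + v i) (l + k).
Proof.
move=> ul vk eps eps0; have [M uM] := ul _ eps0; have [N vN] := vk _ eps0.
exists (maxn M N) => i; rewrite geq_max => /andP[Mi Ni].
rewrite opprD addrACA; apply: le_lt_trans (absval_ultra normP _ _) _.
by rewrite gt_max uM ?vN.
Qed.

Lemma converges_toZ (c : nat -> F) l v : converges_to abs c l ->
  converges_to norm (fun i => c i *: v) (l *: v).
Proof.
move=> cl eps eps0; have v1 : 0 < norm v + 1.
  by rewrite ltr_wpDl ?(absval_ge0 normP).
have [M cM] := cl _ (divr_gt0 eps0 v1).
exists M => i Mi; rewrite -scalerBl normZ.
have := cM i Mi; rewrite ltr_pdivlMr //; apply: le_lt_trans.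
by rewrite ler_wpM2l // lerDl.
Qed.

Lemma converges_to_sum d (u : 'I_d -> nat -> L) (l : 'I_d -> L) :
  (forall i, converges_to norm (u i) (l i)) ->
  converges_to norm (fun k => \sum_i u i k) (\sum_i l i).
Proof.
elim: d u l => [|d IH] u l ul.
  by move=> eps eps0; exists 0%N => k _; rewrite !big_ord0 subrr nabs0.
rewrite big_ord_recl => eps eps0.
have [N uN] := converges_toD (ul ord0) (IH _ _ (fun i => ul (lift ord0 i))) eps0.
by exists N => k Nk; rewrite big_ord_recl uN.
Qed.

Lemma converges_to_lim_eq (u : nat -> L) l v : converges_to norm u l ->
  (forall eps, 0 < eps -> exists N, forall i, (N <= i)%N -> norm (u i - v) < eps) ->
  v = l.
Proof.
move=> ul uv; apply/eqP; rewrite -subr_eq0; apply/negPn/negP => vl.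
have e0 := nabs_gt0 normP vl; have [M uM] := ul _ e0; have [N uN] := uv _ e0.
suff : norm (v - l) < norm (v - l) by rewrite ltxx.
rewrite -{1}(subrKA (u (maxn M N))) -[v - _]opprB.
apply: le_lt_trans (absval_ultra normP _ _) _.
by rewrite gt_max nabsN // uM ?uN ?leq_maxl ?leq_maxr.
Qed.

(** Coordinates along [X] depend continuously on the vector. Indexing them by [nat] makes passage to
    the tail of [X] a plain shift. *)
Definition coord_bounded (X : seq L) (C : R) := forall c : nat -> F,
  forall i, (i < size X)%N ->
    abs (c i) <= C * norm (\sum_(j < size X) c j *: X`_j).

Lemma coord_bounded_complete X C (u : nat -> L) : coord_bounded X C ->
  (forall k, u k \in <<X>>%VS) -> cauchy_for norm u ->
  exists2 l, l \in <<X>>%VS & converges_to norm u l.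
Proof.
move=> XC uX cu.
have [c def_u] : exists c : nat -> nat -> F,
    forall k, u k = \sum_(j < size X) c k j *: X`_j.
  have /choice[c cP] : forall k, exists c : 'I_(size X) -> F,
      u k = \sum_j c j *: X`_j.
    by move=> k; exists (fun j => coord (in_tuple X) j (u k)); apply: coord_span.
  exists (fun k j => if insub j is Some j' then c k j' else 0) => k.
  by rewrite cP; apply: eq_bigr => j _; rewrite valK.
have [l cl] : exists l : nat -> F, forall j, (j < size X)%N ->
    converges_to abs (c ^~ j) (l j).
  have /choice[l lP] : forall j, exists l, (j < size X)%N ->
      converges_to abs (c ^~ j) l.
    move=> j; case: (ltnP j (size X)) => jX; last by exists 0.
    have [|l lP] := @abs_complete (c ^~ j); last by exists l.
    move=> eps eps0; have C1 : 0 < `|C| + 1 by rewrite ltr_wpDl.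
    have [N uN] := cu _ (divr_gt0 eps0 C1); exists N => i k Ni Nk.
    have := uN _ _ Ni Nk; rewrite ltr_pdivlMr //; apply: le_lt_trans.
    have := XC (fun j => c i j - c k j) j jX; move/le_trans; apply.
    under eq_bigr do rewrite scalerBl.
    rewrite sumrB -!def_u mulrC ler_wpM2l ?(absval_ge0 normP) //.
    by rewrite (le_trans (ler_norm _)) // lerDl.
  by exists l.
exists (\sum_(j < size X) l j *: X`_j).
  by apply: rpred_sum => j _; rewrite rpredZ // memv_span // mem_nth.
have ul := converges_to_sum (fun j => converges_toZ (X`_j) (cl j (ltn_ord j))).
by move=> eps eps0; have [N uN] := ul _ eps0; exists N => i Ni; rewrite def_u uN.
Qed.

(** Induction on [X]: the span of the tail is complete, hence closed, so the new vector [v] has a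
    positive distance to it, and this controls its coefficient. *)
Lemma free_coord_bounded X : free X -> exists C, coord_bounded X C.
Proof.
elim: X => [|v X IH]; first by exists 0.
rewrite free_cons => /andP[vX /IH[C XC]] {IH}.
have [d d0 dP] : exists2 d, 0 < d & forall w, w \in <<X>>%VS -> d <= norm (v - w).
  (* Otherwise vectors of the span approach [v], and completeness puts [v] in the span. *)
  apply: contrapT => nd; move/negP: vX; apply.
  have /choice[w wP] : forall k : nat, exists w,
      w \in <<X>>%VS /\ norm (v - w) < k.+1%:R^-1.
    move=> k; apply: contrapT => nw; apply: nd; exists k.+1%:R^-1 => [|w wX].
      by rewrite invr_gt0 ltr0n.
    by rewrite leNgt; apply/negP => vw; apply: nw; exists w.
  have wv eps : 0 < eps -> exists N, forall i, (N <= i)%N -> norm (w i - v) < eps.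
    move=> eps0; exists (Num.bound eps^-1) => i Ni.
    rewrite -opprB nabsN //; apply: lt_trans (wP i).2 _.
    rewrite invf_plt ?posrE //; apply: lt_le_trans (archi_boundP _) _.
      by rewrite invr_ge0 ltW.
    by rewrite ler_nat leqW.
  have [|l lX wl] := coord_bounded_complete XC (fun k => (wP k).1).
    move=> eps eps0; have [N wN] := wv _ eps0; exists N => i j Ni Nj.
    rewrite -(subrKA v) -[v - _]opprB.
    apply: le_lt_trans (absval_ultra normP _ _) _.
    by rewrite gt_max nabsN // !wN.
  by rewrite (converges_to_lim_eq wl wv).
(* The coefficient of [v] is bounded through [d^-1]; [B] then bounds the rest of the combination,
   which is [S - c 0%N *: v]. *)
pose B := Num.max 1 (norm v / d).
exists (Num.max d^-1 (`|C| * B)) => c.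
set S := \sum_(j < _) _.
pose w := \sum_(j < size X) c j.+1 *: X`_j.
have defS : S = c 0%N *: v + w by rewrite /S /= big_ord_recl.
have c0_le : abs (c 0%N) <= d^-1 * norm S.
  have [->|c0] := eqVneq (c 0%N) 0.
    rewrite -norm_abs scale0r nabs0 // mulr_ge0 ?(absval_ge0 normP) //.
    by rewrite invr_ge0 ltW.
  rewrite mulrC ler_pdivlMr //.
  have -> : S = c 0%N *: (v - - (c 0%N)^-1 *: w).
    by rewrite scaleNr opprK scalerDr scalerA divff // scale1r.
  rewrite normZ ler_wpM2l // dP // rpredZ //.
  by apply: rpred_sum => j _; rewrite rpredZ // memv_span // mem_nth.
have w_le : norm w <= B * norm S.
  have -> : w = S - c 0%N *: v by rewrite defS addrAC subrr add0r.
  have nS0 := absval_ge0 normP S; apply: nabsB_le => //.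
    by rewrite ler_peMl // le_max lexx.
  rewrite normZ; apply: le_trans (ler_wpM2r (absval_ge0 normP v) c0_le) _.
  by rewrite mulrAC ler_wpM2r // mulrC le_max lexx orbT.
case=> [_|i iX].
  apply: le_trans c0_le _; rewrite ler_wpM2r ?(absval_ge0 normP) //.
  by rewrite le_max lexx.
apply: le_trans (XC (fun j => c j.+1) i iX) _.
apply: le_trans (ler_wpM2r (absval_ge0 normP w) (ler_norm C)) _.
apply: le_trans (ler_wpM2l (normr_ge0 C) w_le) _.
by rewrite mulrA ler_wpM2r ?(absval_ge0 normP) // le_max lexx orbT.
Qed.

Lemma finite_ext_complete (u : nat -> L) : cauchy_for norm u ->
  exists l, converges_to norm u l.
Proof.
have [C XC] := free_coord_bounded (basis_free (vbasisP {:L})).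
move=> cu; have [k|l _ ul] := coord_bounded_complete XC _ cu; last by exists l.
by rewrite (span_basis (vbasisP _)) memvf.
Qed.

End FiniteExtensionComplete.

Lemma padic_norm_p (R : realType) p : prime p ->
  padic_norm R p p%:R = p%:R^-1.
Proof.
move=> p_prime; have p0 := prime_gt0 p_prime.
rewrite /padic_norm pnatr_eq0 eqn0Ngt p0 /=.
have -> : p%:R = p%:Z%:~R :> rat by [].
by rewrite numq_int denq_int !absz_nat logn1 expr0 logn_prime // eqxx expr1 mul1r.
Qed.

Lemma expr_invp_small (R : realType) (p : nat) (eps : R) : (1 < p)%N -> 0 < eps ->
  exists2 k, (0 < k)%N & forall j, (k <= j)%N -> p%:R^-1 ^+ j < eps.
Proof.
move=> p1 e0; exists (Num.bound eps^-1).+1 => // j kj.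
have p0 : (0 < p)%N by apply: ltnW.
rewrite exprVn invf_plt ?posrE ?exprn_gt0 ?ltr0n //.
apply: lt_le_trans (archi_boundP _) _; first by rewrite invr_ge0 ltW.
by rewrite -natrX ler_nat; apply: ltnW (leq_trans kj (ltnW (ltn_expl j p1))).
Qed.

Lemma dim_span_col (K : fieldType) n g (M : 'M[K]_(n, g)) :
  (forall c : 'cV_g, M *m c = 0 -> c = 0) ->
  \dim <<[seq col l M | l <- enum 'I_g]>>%VS = g.
Proof.
move=> Mfree; pose X := map_tuple (fun l => col l M) (ord_tuple g).
have -> : [seq col l M | l <- enum 'I_g] = X by [].
suff /eqP-> : free X by rewrite size_tuple.
apply/freeP => k Xk i; suff : \col_l k l = 0.
  by move/matrixP/(_ i 0); rewrite !mxE.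
apply: Mfree; rewrite -[RHS]Xk; apply/colP => j; rewrite mxE summxE.
apply: eq_bigr => l _; rewrite -tnth_nth tnth_map tnth_ord_tuple !mxE.
exact: mulrC.
Qed.

(** * Uniform limits at a geometric rate *)

Section UniformLimit.
Variables (R : realType) (F : fieldType) (norm : F -> R).
Hypothesis normP : nonarch_absval norm.
Hypothesis complete : forall u : nat -> F, cauchy_for norm u ->
  exists l : F, converges_to norm u l.
Variable p : nat.
Hypothesis p_gt1 : (1 < p)%N.
Local Notation rho := (p%:R^-1 : R).

Lemma geometric_limit (u : nat -> F) :
  (forall k s, (0 < k <= s)%N -> norm (u s - u k) <= rho ^+ k) ->
  exists l, forall k, (0 < k)%N -> norm (u k - l) <= rho ^+ k.
Proof.
move=> uC; have [|l ul] := @complete u.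
  move=> eps e0; have [k k0 ke] := expr_invp_small p_gt1 e0.
  exists k => i j ki kj; apply: le_lt_trans (ke k (leqnn k)).
  by rewrite -(subrKA (u k)) -[u k - _]opprB nabsB_le // uC ?k0.
exists l => k k0; have rk0 : 0 < rho ^+ k by rewrite exprn_gt0 // invr_gt0 ltr0n ltnW.
have [N uN] := ul _ rk0.
rewrite -(subrKA (u (maxn k N))) -[u k - _]opprB nabsD_le //.
  by rewrite nabsN // uC // k0 leq_maxl.
by apply/ltW/uN; rewrite leq_maxr.
Qed.

(** The rate is the same at every point of [D], so limits chosen pointwise are uniform. *)
Lemma geometric_uniform_limit n g (D : set ('I_n -> F))
    (f : nat -> ('I_n -> F) -> 'M[F]_(n, g)) :
  (forall a, D a -> forall k s i l, (0 < k <= s)%N ->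
     norm (f s a i l - f k a i l) <= rho ^+ k) ->
  exists J, uniform_limit_on norm D f J.
Proof.
move=> fD.
have /choice[J JP] : forall a, exists J : 'M[F]_(n, g), D a ->
    forall k i l, (0 < k)%N -> norm (f k a i l - J i l) <= rho ^+ k.
  move=> a; have [Da|nDa] := pselect (D a); last by exists 0.
  have /choice[J JP] : forall il : 'I_n * 'I_g, exists z, forall k, (0 < k)%N ->
      norm (f k a il.1 il.2 - z) <= rho ^+ k.
    by move=> [i l]; apply: geometric_limit => k s; apply: fD.
  exists (\matrix_(i, l) J (i, l)) => _ k i l k0; rewrite mxE.
  exact: (JP (i, l)).
exists J => eps e0; have [k k0 ke] := expr_invp_small p_gt1 e0.
exists k => s ks a Da i l; apply: le_lt_trans (ke s ks).
exact: JP (leq_trans k0 ks).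
Qed.

End UniformLimit.

(** * Rank of the limit matrix at a point with distinct coordinates *)

Theorem theorem6p12 (p q e g n m : nat)
  (p_prime : prime p) (q_prime : prime q) (lt_qp : (q < p)%N) (p_odd : odd p)
  (e_order : is_order_mod p q e)
  (g_gt0 : (0 < g)%N) (def_n : n = (g * q + 1)%N)
  (lt_n_pe : (n < p ^ e)%N) (le_nq_p : (n + q - 2 <= p)%N)
  (m_gt0 : (0 < m)%N)
  (R : realType) (Qp : fieldType) (abs : Qp -> R) (QpP : is_Qp p abs)
  (K : fieldExtType Qp) (norm : K -> R) (KP : is_unramified_ext abs m norm)
  (lt_d_pm : (d_Phi p q e g + d_M p q e g < p ^ m)%N) :
  forall a : 'I_n -> K, D_KZo norm p q e g a -> \dim (calL norm p q e g a) = g.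
Proof.
move=> a [Da a_neq]; have normP := unram_absval KP.
have [e_gt0 pe1 _] := e_order; have p_gt1 := prime_gt1 p_prime.
have q_gt0 := prime_gt0 q_prime; have q_gt1 := prime_gt1 q_prime.
have np : norm p%:R = p%:R^-1.
  rewrite -scaler_nat -[p%:R in LHS]/(p%:R : Qp) (unram_extends KP).
  by rewrite -(padic_norm_p R p_prime) -(Qp_norm QpP) ratr_nat.
have np_lt1 : norm p%:R < 1 by rewrite np invf_lt1 ?ltr1n ?ltr0n // ltnW.
have K_complete := finite_ext_complete normP (unram_extends KP) (Qp_complete QpP).
(* As [q > 1], [n - q] is smaller than [n + q - 2]. *)
have lt_nq_p : (n - q < p)%N by lia.
pose f s b := Imx p q e s g b *m invmx (Amx p q e s g b) : 'M[K]_(n, g).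
(* Existence of a limit ensures that [xget] returns one instead of its default 0. *)
have calI_lim : uniform_limit_on norm (@D_KZ R K norm p q e g n) f
    (calI norm p q e g (n := n)).
  apply: (xgetPex (fun=> 0)).
  apply: (geometric_uniform_limit normP K_complete p_gt1) => b [b1 det1] k s i l ks.
  by rewrite -np; apply: Jmx_congr.
apply: dim_span_col => c Mc0; have [a1 det1] := Da.
have a_inj : injective a.
  by move=> i j; apply: contra_eq; exact: a_neq.
(* [C] bounds the inverse Lagrange denominators and [D] the entries of [c], both independently of
   [s]; the summand 1 gives [1 <= C]. *)
pose C : R := 1 + \sum_i norm ((root_cofactor a i).[a i])^-1.
pose D : R := \sum_l norm (c l 0).
have n0 := absval_ge0 normP.
have D0 : 0 <= D by apply: sumr_ge0.
have cD l : norm (c l 0) <= D by rewrite /D (bigD1 l) //= lerDl sumr_ge0.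
have C1 : 1 <= C by rewrite lerDl sumr_ge0.
have C_cof i : norm ((root_cofactor a i).[a i])^-1 <= C.
  by rewrite /C (bigD1 i) //= addrCA lerDl addr_ge0 // sumr_ge0.
have small eps u : 0 < eps -> norm (c u 0) <= C * D * eps.
  move=> e0; have [N fN] := calI_lim _ e0.
  have [k k0 ke] := expr_invp_small p_gt1 e0.
  (* Large enough both for the uniform limit and for [p%:R^-1 ^+ s < eps]. *)
  pose s := maxn N k; have s0 : (0 < s)%N by rewrite leq_max k0 orbT.
  have uA := Amx_unit normP p_prime p_odd np_lt1 q_gt0 pe1 def_n lt_n_pe e_gt0
    g_gt0 a1 det1 s0.
  pose y := invmx (Amx p q e s g a) *m c.
  have y_le l : norm (y l 0) <= D.
    rewrite -[D]mul1r; apply: nabs_mulmx_le => //.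
      by move=> i; exact: (nabs_invAmx normP p_prime p_odd np_lt1 q_gt0 pe1 def_n
        lt_n_pe e_gt0 g_gt0 a1 det1).
    by move=> i j; rewrite (ord1 j).
  have Iy_le i : norm ((Imx p q e s g a *m y) i 0) <= eps * D.
    (* The left side is J_s c, and subtracting the zero vector [calI a *m c] leaves the error of the
       limit applied to [c]. *)
    rewrite mulmxA -[_ *m c]subr0 -Mc0 -mulmxBl; apply: nabs_mulmx_le => //.
    - exact: ltW.
    - by move=> l; rewrite mxBE; apply/ltW; exact: fN (leq_maxl _ _) _ Da i l.
    - by move=> l j; rewrite (ord1 j).
  have -> : c u 0 = (Amx p q e s g a *m y) u 0 by rewrite mulKVmx.
  apply: le_trans (nabs_Amx_mul normP p_prime p_odd np_lt1 q_gt0 pe1 def_n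
    lt_n_pe e_gt0 g_gt0 a1 lt_nq_p s0 a_inj C1 C_cof y_le Iy_le u) _.
  rewrite -mulrA ler_wpM2l ?(le_trans ler01 C1) // ge_max [eps * D]mulrC lexx.
  by rewrite ler_wpM2l // np ltW // ke // leq_maxr.
apply/colP => u; rewrite mxE; apply/eqP/negPn/negP => cu0.
have cu := nabs_gt0 normP cu0.
have CD : 0 <= C * D by rewrite mulr_ge0 // (le_trans _ C1).
have CD1 : 0 < C * D + 1 by rewrite ltr_wpDl.
(* With [eps] equal to [norm (c u 0) / (C * D + 1)] the bound forces [norm (c u 0) <= 0]. *)
have := small _ u (divr_gt0 cu CD1).
by rewrite mulrA ler_pdivlMr // mulrC mulrDl mul1r gerDl leNgt cu.
Qed.
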